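(* Let $n,l\ge 1$ and $N\ge 0$ be integers, let $f:\mathbb{R}^n\times\mathbb{R}\to\mathbb{R}^n$, $L:\mathbb{R}^n\times\mathbb{R}\to\mathbb{R}$ and $c_i:\mathbb{R}^n\times\mathbb{R}\to\mathbb{R}$ ($i=1,\dots,l$) be differentiable, let $\xi\in\mathbb{R}^n$, $\sigma>0$, and $\gamma_{i,k}\in\mathbb{R}$ for $i=1,\dots,l$, $k=0,\dots,N$. For a control sequence $\boldsymbol{u}=(u_0,\dots,u_N)\in\mathbb{R}^{N+1}$ let $x_0=\xi$ and $x_{k+1}=f(x_k,u_k)$ for $k=0,\dots,N$, and define $$\widetilde J(\boldsymbol{u})=\sum_{k=0}^{N}L(x_k,u_k)+\frac{1}{2\sigma}\sum_{i=1}^{l}\sum_{k=0}^{N}\Big\{\big[\max(0,\gamma_{i,k}+\sigma c_i(x_k,u_k))\big]^2-\gamma_{i,k}^2\Big\}.$$ For $k=0,\dots,N$ and $x,\lambda\in\mathbb{R}^n$, $u\in\mathbb{R}$, define the Hamiltonian $$\mathcal{H}^{(k)}(x,u,\lambda)=L(x,u)+\lambda^{T}f(x,u)+\frac{1}{2\sigma}\sum_{i=1}^{l}\Big\{\big[\max(0,\gamma_{i,k}+\sigma c_i(x,u))\big]^2-\gamma_{i,k}^2\Big\}.$$ Given $\boldsymbol{u}$ and the corresponding states $x_0,\dots,x_N$, let the costates $\lambda_1,\dots,\lambda_{N+1}\in\mathbb{R}^n$ be defined by the backward recursion $$\lambda_{N+1}=\boldsymbol{0},\qquad \lambda_k=\frac{\partial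 \mathcal{H}^{(k)}}{\partial x}(x_k,u_k,\lambda_{k+1}),\quad k=N,N-1,\dots,1.$$ Then the gradient of $\widetilde J$ with respect to $\boldsymbol{u}$ (with $\xi$, $\gamma_{i,k}$, $\sigma$ fixed) at every $\boldsymbol{u}\in\mathbb{R}^{N+1}$ is $$\nabla\widetilde J(\boldsymbol{u})=\left[\frac{\partial\mathcal{H}^{(0)}}{\partial u}(x_0,u_0,\lambda_1),\ \dots,\ \frac{\partial\mathcal{H}^{(N)}}{\partial u}(x_N,u_N,\lambda_{N+1})\right]^T.$$
   Context: Partial derivatives of a Hamiltonian are taken treating its arguments $x$, $u$, $\lambda$ as independent variables and are then evaluated at the indicated point. The derivative $\partial\mathcal{H}^{(k)}/\partial x$ of a scalar function with respect to a vector is regarded as a column vector in $\mathbb{R}^n$. The function $\widetilde J$ is viewed as a function of the control sequence only, the states $x_k$ being determined by the controls through the forward recursion. *)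

(* Defs.v *)
From HB Require Import structures.
From mathcomp Require Import all_boot all_order all_algebra.
From mathcomp Require Import all_classical all_reals all_analysis.

Set Implicit Arguments.
Unset Strict Implicit.
Unset Printing Implicit Defensive.
Import Order.TTheory GRing.Theory Num.Theory.
Import numFieldNormedType.Exports.

Local Open Scope ring_scope.

(* The column vector of partial derivatives; 'D_v is total, so existence of
   the derivatives has to be asserted separately where it matters. *)
Definition gradient (R : realType) (m : nat) (g : 'cV[R]_m -> R)
    (a : 'cV[R]_m) : 'cV[R]_m :=
  \col_(i < m) 'D_(delta_mx i 0) g a.

Section OptimalControl.
Variables (R : realType) (n l N : nat).
Variables (f : 'cV[R]_n * R -> 'cV[R]_n) (L : 'cV[R]_n * R -> R).
Variable c : 'I_l -> 'cV[R]_n * R -> R.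
Variables (xi : 'cV[R]_n) (sigma : R) (gamma : 'I_l -> 'I_N.+1 -> R).

(* [inord k] is the index k as long as k <= N, so [state u k] is the state x_k
   for every k <= N.+1; later values are meaningless and never used. *)
Fixpoint state (u : 'cV[R]_N.+1) (k : nat) : 'cV[R]_n :=
  if k is j.+1 then f (state u j, u (inord j) 0) else xi.

Definition augmented_cost (u : 'cV[R]_N.+1) : R :=
  \sum_(k < N.+1) L (state u k, u k 0)
  + (2 * sigma)^-1 *
    \sum_(i < l) \sum_(k < N.+1)
      (Num.max 0 (gamma i k + sigma * c i (state u k, u k 0)) ^+ 2
       - gamma i k ^+ 2).

Definition hamiltonian (k : 'I_N.+1) (x : 'cV[R]_n) (u : R)
    (lambda : 'cV[R]_n) : R :=
  L (x, u) + (lambda^T *m f (x, u)) 0 0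
  + (2 * sigma)^-1 *
    \sum_(i < l)
      (Num.max 0 (gamma i k + sigma * c i (x, u)) ^+ 2 - gamma i k ^+ 2).

Definition hamiltonian_x (k : 'I_N.+1) (x : 'cV[R]_n) (u : R)
    (lambda : 'cV[R]_n) : 'cV[R]_n :=
  gradient (fun y => hamiltonian k y u lambda) x.

Definition hamiltonian_u (k : 'I_N.+1) (x : 'cV[R]_n) (u : R)
    (lambda : 'cV[R]_n) : R :=
  derive1 (fun v : R => hamiltonian k x v lambda) u.

(* Only lambda 1, ..., lambda N.+1 are constrained. *)
Definition is_costate (u : 'cV[R]_N.+1) (lambda : nat -> 'cV[R]_n) : Prop :=
  lambda N.+1 = 0 /\
  forall k : 'I_N.+1, (0 < k)%N ->
    lambda k = hamiltonian_x k (state u k) (u k 0) (lambda k.+1).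

End OptimalControl.

(* Main.v *)
(* The differentials X_k of the states satisfy X_0 = 0 and
   X_(k+1) = f'(x_k, u_k)(X_k, v_k).  Writing the stage cost as
   H^(k)(., lambda_(k+1)) - lambda_(k+1)^T f, the costate recursion turns the
   differential of the k-th stage cost along v into
   dH^(k)/du v_k + lambda_k^T X_k - lambda_(k+1)^T X_(k+1),
   and the last two terms telescope to 0 since X_0 = 0 and lambda_(N+1) = 0.
   The penalty is differentiable because max(0, t)^2 is. *)

Require Import Defs.
From HB Require Import structures.
From mathcomp Require Import all_boot all_order all_algebra.
From mathcomp Require Import all_classical all_reals all_analysis.
From mathcomp Require Import lra.
Import Order.TTheory GRing.Theory Num.Theory.
Import numFieldNormedType.Exports.
Local Open Scope ring_scope.

(** * Differentiability of the squared positive part *)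

(** First-order Taylor bound with candidate derivative [2 * Num.max 0 t]. The remainder is [h ^+ 2]
    or 0 if [t] and [h + t] have the same sign; across the kink it is [(h + t) ^+ 2] or
    [h ^+ 2 - (h + t) ^+ 2]. *)
Lemma sqr_pos_part_taylor {R : realDomainType} (t h : R) :
  `|Num.max 0 (h + t) ^+ 2 - Num.max 0 t ^+ 2 - 2 * Num.max 0 t * h| <= h ^+ 2.
Proof.
have h2 := sqr_ge0 h; have t2 := sqr_ge0 t; have ht2 := sqr_ge0 (h + t).
rewrite ler_norml /Num.max; case: ltP => ?; case: ltP => ?; apply/andP; split.
all: nra.
Qed.

Lemma differentiable_sqr_pos_part {R : realType} (t : R) :
  differentiable (fun s : R => Num.max 0 s ^+ 2) t.
Proof.
apply/derivable1_diffP/cvg_ex; exists (2 * Num.max 0 t).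
apply/cvgrPdist_le => e e0; near=> h.
have h0 : h != 0 by near: h; exact: nbhs_dnbhs_neq.
(* The difference quotient is within [|h|] of the limit, so the radius can be [e] itself. *)
have he : `|h| <= e.
  near: h; apply: nbhs_dnbhs; apply/nbhs_ballP; exists e => //= h.
  by rewrite /ball /= sub0r normrN => /ltW.
apply: le_trans he; rewrite scaler1 distrC.
rewrite -(@ler_pM2l _ `|h|) ?normr_gt0// -!normrM -expr2.
rewrite [leRHS]ger0_norm ?sqr_ge0//.
have := sqr_pos_part_taylor t h; congr (`|_| <= _).
by rewrite mulrBr /= mulrA divff// mul1r [h * _]mulrC.
Unshelve. all: by end_near.
Qed.

(** * Differentials of linear forms, gradients and partial derivatives *)

Lemma diff_coord {R : realType} {m n : nat} (M V : 'M[R]_(m, n)) i j :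
  'd (fun N : 'M[R]_(m, n) => N i j : R) M V = V i j.
Proof.
have cl : linear (fun N : 'M[R]_(m, n) => N i j : R).
  by move=> k A B; rewrite !mxE.
pose cm := GRing.isLinear.Build _ _ _ _ _ cl.
pose f : {linear _ -> _} := HB.pack (fun N : 'M[R]_(m, n) => N i j : R) cm.
by rewrite (_ : (fun _ => _) = f)// diff_lin//; exact: coord_continuous.
Qed.

Section Dot.
Context {R : realType} {n : nat}.
Implicit Types a y : 'cV[R]_n.

Definition dot a y : R := (a^T *m y) 0 0.

Lemma dot_is_linear a : linear (dot a).
Proof. by move=> k x y; rewrite /dot mulmxDr -scalemxAr !mxE. Qed.

Lemma dot0l y : dot 0 y = 0.
Proof. by rewrite /dot trmx0 mul0mx mxE. Qed.

HB.instance Definition _ a :=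
  GRing.isLinear.Build R 'cV[R]_n R *%R (dot a) (dot_is_linear a).

Lemma dot_continuous a : continuous (dot a).
Proof.
move=> y; apply: differentiable_continuous.
(* Continuity comes from writing the form as a finite combination of coordinates. *)
have -> : dot a = \sum_(i < n) (fun y : 'cV[R]_n => a i 0 *: (y i 0 : R)).
  apply/funext => z; rewrite /dot mxE fct_sumE.
  by apply: eq_bigr => i _; rewrite mxE.
apply: differentiable_sum => i; apply: differentiableZ.
exact: differentiable_coord.
Qed.

Lemma differentiable_dot {V : normedModType R} a (g : V -> 'cV[R]_n) x :
  differentiable g x -> differentiable (fun z => dot a (g z)) x.
Proof.
move=> dg; apply: (@differentiable_comp _ _ _ _ g (dot a)) => //.
exact/linear_differentiable/dot_continuous.
Qed.

Lemma diff_dot {V : normedModType R} a (g : V -> 'cV[R]_n) x v :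
  differentiable g x -> 'd (fun z => dot a (g z)) x v = dot a ('d g x v).
Proof.
move=> dg; have dd := linear_differentiable (g x) (@dot_continuous a).
by rewrite (@diff_comp _ _ _ _ g (dot a)) //= diff_lin//; exact: dot_continuous.
Qed.

Lemma diffD_dot {V : normedModType R} (h : V -> R) a (g : V -> 'cV[R]_n) x v :
  differentiable h x -> differentiable g x ->
  'd (fun z => h z + dot a (g z)) x v = 'd h x v + dot a ('d g x v).
Proof.
move=> dh dg; rewrite -diff_dot// (_ : (fun z => _) = h + (fun z => dot a (g z)))//.
by rewrite diffD//; exact: differentiable_dot.
Qed.

End Dot.

Lemma diff_gradient {R : realType} {m : nat} (g : 'cV[R]_m -> R) (a v : 'cV_m) :
  differentiable g a -> 'd g a v = dot (gradient g a) v.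
Proof.
move=> dg; rewrite /dot [in LHS](matrix_sum_delta v) mxE linear_sum.
apply: eq_bigr => i _; rewrite big_ord1 linearZ/= !mxE deriveE//.
by rewrite mulrC.
Qed.

(** Splits the total differential by [(y, t) = (y, 0) + (0, t)]; each summand is the image of a
    vector under the differential of a slice embedding [z => (z, w)] or [s => (x, s)], so the chain
    rule yields the partial derivatives. *)
Lemma diff_partial {R : realType} {n : nat} (g : 'cV[R]_n * R -> R) x w y t :
  differentiable g (x, w) ->
  'd g (x, w) (y, t) = dot (gradient (fun z => g (z, w)) x) y
                       + t * derive1 (fun s => g (x, s)) w.
Proof.
move=> dg.
have dl : is_diff x (fun z : 'cV[R]_n => (z, w)) (fun z => (z, 0)).
  exact: (is_diff_pair (df := id) (dg := 0)).
have dr : is_diff w (fun s : R => (x, s)) (fun s => (0, s)).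
  exact: (is_diff_pair (df := 0) (dg := id)).
have -> : (y, t) = (y, 0) + (0, t) :> 'cV[R]_n * R.
  by congr pair; rewrite /= ?addr0 ?add0r.
rewrite linearD /= -diff_gradient; last exact: (@differentiable_comp _ _ _ _ _ g).
rewrite derive1E'; last exact: (@differentiable_comp _ _ _ _ _ g).
rewrite (@diff_comp _ _ _ _ (fun z => (z, w)) g)// diff_val/=; congr (_ + _).
rewrite -[t * _]linearZ/= (@diff_comp _ _ _ _ (fun s => (x, s)) g)// diff_val/=.
by rewrite [t *: 1]mulr1.
Qed.

(** * Differentials of states and cost *)

Section OptimalControl.
Context {R : realType} {n l N : nat}.
Variables (f : 'cV[R]_n * R -> 'cV[R]_n) (L : 'cV[R]_n * R -> R)
  (c : 'I_l -> 'cV[R]_n * R -> R).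
Hypothesis df : forall p, differentiable f p.
Hypothesis dL : forall p, differentiable L p.
Hypothesis dc : forall i p, differentiable (c i) p.
Variables (xi : 'cV[R]_n) (sigma : R) (gamma : 'I_l -> 'I_N.+1 -> R).

Let H k lam (p : 'cV[R]_n * R) := hamiltonian f L c sigma gamma k p.1 p.2 lam.
Let X k (u : 'cV[R]_N.+1) := state f xi u k.

Lemma hamiltonianE k lam p : H k lam p = H k 0 p + dot lam (f p).
Proof.
case: p => x w; rewrite /H /hamiltonian /= -!/(dot _ _) dot0l addr0.
exact: addrAC.
Qed.

(* With costate 0 the Hamiltonian is the stage cost. *)
Lemma augmented_costE u :
  augmented_cost f L c xi sigma gamma u =
  \sum_(k < N.+1) H k 0 (X k u, u k 0).
Proof.
rewrite /H /augmented_cost /hamiltonian big_split/= -mulr_sumr exchange_big/=.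
congr (_ + _); apply: eq_bigr => k _.
by rewrite -/(dot _ _) dot0l addr0.
Qed.

Lemma differentiable_hamiltonian k lam p : differentiable (H k lam) p.
Proof.
have -> : H k lam =
    L + (fun q => dot lam (f q)) + (2 * sigma)^-1 *: \sum_(i < l)
      (fun q => Num.max 0 (gamma i k + sigma * c i q) ^+ 2 - gamma i k ^+ 2).
  by apply/funext => -[x w]; rewrite /H /hamiltonian /= !fctE fct_sumE.
apply: differentiableD; first exact/differentiableD/differentiable_dot.
apply: differentiableZ; apply: differentiable_sum => i.
apply: differentiableB => //.
apply: (@differentiable_comp _ _ _ _ (fun q => gamma i k + sigma * c i q)
  (fun s => Num.max 0 s ^+ 2)); last exact: differentiable_sqr_pos_part.
apply: differentiableD => //; exact: differentiableZ.
Qed.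

Lemma differentiable_state k u : differentiable (X k) u.
Proof.
elim: k => [|k IH]; first exact: differentiable_cst.
apply: (@differentiable_comp _ _ _ _ (fun v => (X k v, v (inord k) 0)) f) => //.
by apply: differentiable_pair => //; exact: differentiable_coord.
Qed.

Lemma differentiable_stage_point (k : 'I_N.+1) u :
  differentiable (fun v => (X k v, v k 0)) u.
Proof.
apply: differentiable_pair; first exact: differentiable_state.
exact: differentiable_coord.
Qed.

Lemma diff_stage_point (k : 'I_N.+1) u v :
  'd (fun v => (X k v, v k 0)) u v = ('d (X k) u v, v k 0).
Proof.
rewrite diff_pair/=; [|exact: differentiable_state|exact: differentiable_coord].
by rewrite diff_coord.
Qed.

Lemma diff_state_succ (k : 'I_N.+1) u v :
  'd (X k.+1) u v = 'd f (X k u, u k 0) ('d (X k) u v, v k 0).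
Proof.
rewrite -diff_stage_point.
have -> : X k.+1 = f \o (fun v => (X k v, v k 0)).
  (* Since [k] is an ordinal below [N.+1], the [inord k] in the recursion for [state] is [k]
     itself. *)
  by apply/funext => w; rewrite /X /= inord_val.
by rewrite diff_comp//; exact: differentiable_stage_point.
Qed.

Lemma differentiable_augmented_cost u :
  differentiable (augmented_cost f L c xi sigma gamma) u.
Proof.
have -> : augmented_cost f L c xi sigma gamma =
    \sum_(k < N.+1) (H k 0 \o fun v => (X k v, v k 0)).
  by apply/funext => v; rewrite augmented_costE fct_sumE.
apply: differentiable_sum => k; apply: differentiable_comp.
  exact: differentiable_stage_point.
exact: differentiable_hamiltonian.
Qed.

Lemma diff_augmented_cost u v :
  'd (augmented_cost f L c xi sigma gamma) u v =
  \sum_(k < N.+1) 'd (H k 0) (X k u, u k 0) ('d (X k) u v, v k 0).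
Proof.
have -> : augmented_cost f L c xi sigma gamma =
    \sum_(k < N.+1) (H k 0 \o fun v => (X k v, v k 0)).
  by apply/funext => w; rewrite augmented_costE fct_sumE.
have dP (k : 'I_N.+1) := @differentiable_stage_point k u.
have dH k p := @differentiable_hamiltonian k 0 p.
have dG k : differentiable (H k 0 \o fun v => (X k v, v k 0)) u.
  exact: differentiable_comp.
(* The sum is split at the level of directional derivatives, then each term returns to a
   differential for the chain rule. *)
rewrite -deriveE; last exact: differentiable_sum.
rewrite derive_sum => [|k]; last exact: diff_derivable.
apply: eq_bigr => k _.
rewrite deriveE; last exact: dG.
rewrite -diff_stage_point.
have /(congr1 (fun h => h v)) E := diff_comp (dP k) (dH k _).
exact: E.
Qed.

(** Valid for every [lam]: the term [dot lam f] is added to the stage cost and subtracted again, and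
    the resulting Hamiltonian is split into its partials. *)
Lemma diff_stage_cost k lam x w y t :
  'd (H k 0) (x, w) (y, t) =
  t * hamiltonian_u f L c sigma gamma k x w lam
  + dot (hamiltonian_x f L c sigma gamma k x w lam) y
  - dot lam ('d f (x, w) (y, t)).
Proof.
have dH : 'd (H k lam) (x, w) (y, t)
    = 'd (H k 0) (x, w) (y, t) + dot lam ('d f (x, w) (y, t)).
  have -> : H k lam = (fun q => H k 0 q + dot lam (f q)).
    by apply/funext => q; exact: hamiltonianE.
  by apply: diffD_dot => //; exact: differentiable_hamiltonian.
apply: (addIr (dot lam ('d f (x, w) (y, t)))); rewrite -dH subrK addrC.
by apply: diff_partial; exact: differentiable_hamiltonian.
Qed.

(** * Elimination of the state differentials by the costates *)

Variables (u : 'cV[R]_N.+1) (lambda : nat -> 'cV[R]_n).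
Hypothesis hlambda : is_costate f L c xi sigma gamma u lambda.

(* At k = 0 the costate is unconstrained, but x_0 does not depend on u. *)
Lemma dot_costate (k : 'I_N.+1) v :
  dot (hamiltonian_x f L c sigma gamma k (X k u) (u k 0) (lambda k.+1))
    ('d (X k) u v) = dot (lambda k) ('d (X k) u v).
Proof.
have [k0|k0] := posnP k; last by rewrite hlambda.2.
by rewrite k0 diff_cst /= !linear0.
Qed.

Lemma diff_augmented_costE v :
  'd (augmented_cost f L c xi sigma gamma) u v =
  \sum_(k < N.+1) v k 0 *
    hamiltonian_u f L c sigma gamma k (X k u) (u k 0) (lambda k.+1).
Proof.
(* The telescoping quantity. [T 0] vanishes whatever [lambda 0] is, because the initial state is
   constant in the controls. *)
pose T k := dot (lambda k) ('d (X k) u v).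
have T0 : T 0%N = 0 by rewrite /T diff_cst /= linear0.
have TN : T N.+1 = 0 by rewrite /T hlambda.1 dot0l.
have TS (k : 'I_N.+1) :
    dot (lambda k.+1) ('d f (X k u, u k 0) ('d (X k) u v, v k 0)) = T k.+1.
  exact: congr1 _ (esym (diff_state_succ k u v)).
have sumT : \sum_(k < N.+1) (T k.+1 - T k) = 0.
  rewrite -(big_mkord xpredT (fun k => T k.+1 - T k)) telescope_sumr//.
  by rewrite TN T0 subrr.
(* Subtracting the vanishing telescoping sum on the right reduces the claim to an identity for each
   stage. *)
rewrite diff_augmented_cost -[RHS]subr0 -[X in _ = _ - X]sumT -sumrB.
apply: eq_bigr => k _.
by rewrite (diff_stage_cost k (lambda k.+1)) TS dot_costate opprB addrA.
Qed.

End OptimalControl.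

Theorem theorem1 (R : realType) (n l N : nat) (hn : (0 < n)%N) (hl : (0 < l)%N)
    (f : 'cV[R]_n * R -> 'cV[R]_n) (L : 'cV[R]_n * R -> R)
    (c : 'I_l -> 'cV[R]_n * R -> R)
    (hf : forall p : 'cV[R]_n * R, differentiable f p)
    (hL : forall p : 'cV[R]_n * R, differentiable L p)
    (hc : forall (i : 'I_l) (p : 'cV[R]_n * R), differentiable (c i) p)
    (xi : 'cV[R]_n) (sigma : R) (hsigma : 0 < sigma)
    (gamma : 'I_l -> 'I_N.+1 -> R)
    (u : 'cV[R]_N.+1) (lambda : nat -> 'cV[R]_n)
    (hlambda : is_costate f L c xi sigma gamma u lambda) :
  differentiable (augmented_cost f L c xi sigma gamma) u /\
  gradient (augmented_cost f L c xi sigma gamma) u =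
    \col_(k < N.+1)
      hamiltonian_u f L c sigma gamma k (state f xi u k) (u k 0) (lambda k.+1).
Proof.
have dJ := differentiable_augmented_cost f L c hf hL hc xi sigma gamma u.
split=> //; apply/colP => k.
rewrite !mxE deriveE// (diff_augmented_costE _ _ _ hf hL hc _ _ _ _ _ hlambda).
(* In the direction of the basis vector [delta_mx k 0] only the [k]-th control varies, so one term
   of the sum survives. *)
rewrite (bigD1 k)//= big1 ?addr0 => [|j jk]; first by rewrite mxE !eqxx mul1r.
by rewrite mxE (negPf jk) mul0r.
Qed.
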